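(* Let $\mathbb H$ be the Heisenberg group and let $K\subset V_1$ be a compact, convex set with $-K=K$ and $0\in\mathrm{int}(K)$ (interior in $V_1$). Let $g:K\to\mathbb R$ be Lipschitz. Then there exists $b\in\mathbb R$ such that, for $f:=g+b$, the set $$B=\{v+zZ:\ v\in K,\ -f(-v)\le z\le f(v)\}$$ is the unit ball $\{p\in\mathbb H:N(p)\le1\}$ of a homogeneous norm $N$ on $\mathbb H$.
   Context: The Heisenberg group $\mathbb H$ is the three-dimensional real vector space $\mathrm{span}\{X,Y,Z\}$ with the Lie bracket whose only nontrivial relation is $[X,Y]=Z$, equipped with the group operation $p\cdot q=p+q+\frac12[p,q]$; the neutral element is $0$ and $p^{-1}=-p$. Put $V_1=\mathrm{span}\{X,Y\}$. Dilations: $\delta_\lambda(xX+yY+zZ)=\lambda xX+\lambda yY+\lambda^2zZ$ for $\lambda>0$. A homogeneous norm is a function $N:\mathbb H\to[0,+\infty)$ such that for all $p,q\in\mathbb H$ and $\lambda>0$: $N(p)=0\iff p=0$; $N(pq)\le N(p)+N(q)$; $N(p^{-1})=N(p)$; $N(\delta_\lambda p)=\lambda N(p)$. *)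

(* Defs.v *)
From HB Require Import structures.
From mathcomp Require Import all_boot all_order all_algebra.
From mathcomp Require Import all_classical all_reals all_analysis.
Set Implicit Arguments.
Unset Strict Implicit.
Unset Printing Implicit Defensive.
Import Order.TTheory GRing.Theory Num.Theory.
Import numFieldNormedType.Exports.
Local Open Scope classical_set_scope.
Local Open Scope ring_scope.

(* The triple (x, y, z) stands for x X + y Y + z Z. *)
Definition heisenberg (R : realType) : lmodType R := (R * R * R)%type.

Section Heisenberg.
Variable R : realType.
Local Notation H := (heisenberg R).

Definition hX : H := (1, 0, 0).
Definition hY : H := (0, 1, 0).
Definition hZ : H := (0, 0, 1).

Definition hx (p : H) : R := p.1.1.
Definition hy (p : H) : R := p.1.2.
Definition hz (p : H) : R := p.2.

(* The bilinear alternating bracket determined by [X, Y] = Z and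
   [X, Z] = [Y, Z] = 0. *)
Definition hbracket (p q : H) : H := (hx p * hy q - hy p * hx q) *: hZ.

Definition hmul (p q : H) : H := p + q + 2^-1 *: hbracket p q.

Definition hinv (p : H) : H := - p.

Definition hdil (l : R) (p : H) : H :=
  (l * hx p) *: hX + (l * hy p) *: hY + (l ^+ 2 * hz p) *: hZ.

Record homogeneous_norm (N : H -> R) : Prop := HomogeneousNorm {
  hnorm_ge0 : forall p, 0 <= N p;
  hnorm_eq0 : forall p, N p = 0 <-> p = 0;
  hnorm_mul : forall p q, N (hmul p q) <= N p + N q;
  hnorm_inv : forall p, N (hinv p) = N p;
  hnorm_dil : forall (l : R) p, 0 < l -> N (hdil l p) = l * N p }.

(* V_1 = span {X, Y}, given in the coordinates (x, y) so that it carries the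
   topology and the (max) norm of R * R. *)
Definition horizontal : normedModType R := (R * R)%type.

Definition hincl (v : horizontal) : H := v.1 *: hX + v.2 *: hY.

Definition hbody (K : set horizontal) (f : horizontal -> R) : set H :=
  [set p | exists (v : horizontal) (z : R),
     [/\ K v, - f (- v) <= z <= f v & p = hincl v + z *: hZ]].

End Heisenberg.

(* Main.v *)
(* Let L be a Lipschitz constant of g and let C bound the norm on K.  The set B
   is the unit ball of its dilation gauge as soon as delta_s B . delta_t B is
   contained in B whenever s + t = 1, i.e. as soon as
     s^2 f(v) + t^2 f(w) + (s t / 2) omega(v, w) <= f(s v + t w)   (v, w in K)
   where omega is the area form; the lower half of B follows by replacing
   v, w with -v, -w.  Since 1 - s^2 - t^2 = 2 s t, the constant b contributes
   2 s t b to the difference of the two sides, while writing s^2 = s - s t and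
   using |v - (s v + t w)| = t |v - w| shows that the terms in g and omega are
   O(s t), with constants depending only on L, C and |g 0|. *)
Require Import Defs.
From HB Require Import structures.
From mathcomp Require Import all_boot all_order all_algebra.
From mathcomp Require Import all_classical all_reals all_analysis.
From mathcomp Require Import ring lra.
Set Implicit Arguments.
Unset Strict Implicit.
Unset Printing Implicit Defensive.
Import Order.TTheory GRing.Theory Num.Theory.
Import numFieldNormedType.Exports.
Local Open Scope classical_set_scope.
Local Open Scope ring_scope.

(** * Dilations and the group law in coordinates *)

Lemma hdilE (R : realType) (l : R) (p : heisenberg R) :
  hdil l p = (l * hx p, l * hy p, l ^+ 2 * hz p).
Proof.
rewrite /hdil /hX /hY /hZ.
by congr (_, _, _) => /=; rewrite /GRing.scale /=; ring.
Qed.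

Lemma hmulE (R : realType) (p q : heisenberg R) :
  hmul p q = (hx p + hx q, hy p + hy q,
              hz p + hz q + 2^-1 * (hx p * hy q - hy p * hx q)).
Proof.
case: p => [[x y] z]; case: q => [[x' y'] z'].
rewrite /hmul /hbracket /hZ /hx /hy /hz /=.
by congr (_, _, _) => /=; rewrite /GRing.scale /=; ring.
Qed.

Lemma hdil_hdil (R : realType) (l m : R) (p : heisenberg R) :
  hdil l (hdil m p) = hdil (l * m) p.
Proof. by rewrite !hdilE /hx /hy /hz /=; congr (_, _, _); ring. Qed.

Lemma hdil1 (R : realType) (p : heisenberg R) : hdil 1 p = p.
Proof. by case: p => [[x y] z]; rewrite hdilE expr1n !mul1r. Qed.

Lemma hdil0 (R : realType) (l : R) : hdil l (0 : heisenberg R) = 0.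
Proof. by rewrite hdilE /hx /hy /hz /= !mulr0. Qed.

Lemma hdilN (R : realType) (l : R) (p : heisenberg R) :
  hdil l (hinv p) = hinv (hdil l p).
Proof.
case: p => [[x y] z]; rewrite !hdilE /hinv /hx /hy /hz /=.
by congr (_, _, _) => /=; rewrite mulrN.
Qed.

Lemma hdilM (R : realType) (l : R) (p q : heisenberg R) :
  hdil l (hmul p q) = hmul (hdil l p) (hdil l q).
Proof.
by rewrite !hmulE !hdilE /hx /hy /hz /=; congr (_, _, _); ring.
Qed.

Lemma hmul0r (R : realType) (p : heisenberg R) : hmul p 0 = p.
Proof.
by case: p => [[x y] z]; rewrite hmulE /hx /hy /hz /=; congr (_, _, _); ring.
Qed.

(** * The dilation gauge of a set *)

Definition gauge_scales (R : realType) (B : set (heisenberg R))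
  (p : heisenberg R) : set R := [set l | 0 < l /\ B (hdil l^-1 p)].

Definition gauge (R : realType) (B : set (heisenberg R))
  (p : heisenberg R) : R := inf (gauge_scales B p).

(* The five hypotheses are, in order: symmetry, convexity for the group law,
   absorption, absence of dilation rays (a weak form of boundedness) and
   closedness along dilation orbits. *)
Lemma gauge_norm (R : realType) (B : set (heisenberg R)) :
  (forall p, B p -> B (hinv p)) ->
  (forall s t p q, 0 <= s -> 0 <= t -> s + t = 1 -> B p -> B q ->
     B (hmul (hdil s p) (hdil t q))) ->
  (forall p, exists2 t, 0 < t & B (hdil t p)) ->
  (forall p, (forall t, 0 < t -> B (hdil t p)) -> p = 0) ->
  (forall p, (forall t, 0 < t < 1 -> B (hdil t p)) -> B p) ->
  homogeneous_norm (gauge B) /\ B = [set p | gauge B p <= 1].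
Proof.
move=> Binv Bcvx Babs Bray Bclosed.
have B0 : B 0 by have [t _] := Babs 0; rewrite hdil0.
(* Convexity with [0] as second point makes [B] star-shaped under dilations. *)
have Bdil s p : 0 <= s <= 1 -> B p -> B (hdil s p).
  move=> /andP[s0 s1] Bp.
  rewrite -[hdil s p]hmul0r -(hdil0 (1 - s)).
  by apply: Bcvx => //; lra.
have S0 p : gauge_scales B p !=set0.
  have [t t0 Bt] := Babs p; exists t^-1; split; first by rewrite invr_gt0.
  by rewrite invrK.
have Slb p : has_lbound (gauge_scales B p) by exists 0 => l [/ltW].
(* By [Bdil] the scales are upward closed, so anything strictly above the infimum is a scale;
   whether the infimum is attained stays open here. *)
have Sgt p l : gauge B p < l -> gauge_scales B p l.
  move=> /(inf_lt (S0 p))[m [m0 Bm] ml].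
  have l0 : 0 < l by exact: lt_trans ml.
  split=> //; have -> : l^-1 = (m / l) * m^-1 by field; rewrite !gt_eqF.
  rewrite -hdil_hdil; apply: Bdil => //.
  by rewrite divr_ge0 ?(ltW m0) ?(ltW l0)//= ler_pdivrMr// mul1r ltW.
have Nle p l : gauge_scales B p l -> gauge B p <= l by apply: ge_inf.
have Nge0 p : 0 <= gauge B p by apply: lb_le_inf => // l [/ltW].
have Ndil_le l p : 0 < l -> gauge B (hdil l p) <= l * gauge B p.
  move=> l0; rewrite mulrC -ler_pdivrMr//; apply: lb_le_inf => // m [m0 Bm].
  rewrite ler_pdivrMr//; apply: Nle; split; first exact: mulr_gt0.
  rewrite hdil_hdil; suff -> : (m * l)^-1 * l = m^-1 by [].
  by field; rewrite !gt_eqF.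
have Ninv_le p : gauge B (hinv p) <= gauge B p.
  apply: lb_le_inf => // l [l0 Bl]; apply: Nle; split=> //.
  by rewrite hdilN; exact: Binv.
split; first split.
- exact: Nge0.
- move=> p; split=> [N0|->].
    (* If the gauge vanishes, every [t^-1] is a scale, so the whole dilation ray of [p] lies in
       [B]. *)
    apply: Bray => t t0; rewrite -[t]invrK; apply: (Sgt _ _ _).2.
    by rewrite N0 invr_gt0.
  apply/eqP; rewrite eq_le Nge0 andbT.
  apply/ler_addgt0Pl => e e0; rewrite addr0; apply: Nle; split=> //.
  by rewrite hdil0.
- move=> p q; apply/ler_addgt0Pl => e e0.
  have [l0 Bl] : gauge_scales B p (gauge B p + e / 2) by apply: Sgt; lra.
  have [m0 Bm] : gauge_scales B q (gauge B q + e / 2) by apply: Sgt; lra.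
  rewrite [leRHS](_ : _ = gauge B p + e / 2 + (gauge B q + e / 2));
    last by field.
  move: (gauge B p + e / 2) (gauge B q + e / 2) l0 m0 Bl Bm => l m l0 m0 Bl Bm.
  have lm0 : 0 < l + m by exact: addr_gt0.
  apply: Nle; split=> //.
  (* The dilate of [p q] by [(l + m)^-1] is a product of two points of [B] dilated by the weights
     [l / (l + m)] and [m / (l + m)], which sum to 1. *)
  have rescale k r : 0 < k ->
      hdil (k / (l + m)) (hdil k^-1 r) = hdil (l + m)^-1 r.
    by move=> k0; rewrite hdil_hdil; congr hdil; field; rewrite !gt_eqF.
  rewrite hdilM -(rescale l p l0) -(rescale m q m0).
  apply: Bcvx => //; try by rewrite divr_ge0 ?ltW.
  by rewrite -mulrDl divff// gt_eqF.
- move=> p; apply/eqP; rewrite eq_le Ninv_le /=.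
  by rewrite -[X in gauge B X <= _]opprK; exact: Ninv_le.
(* The reverse inequality is [Ndil_le] for [l^-1] at the point [hdil l p]. *)
- move=> l p l0; apply/eqP; rewrite eq_le Ndil_le//= mulrC -ler_pdivlMr//.
  have li0 : 0 < l^-1 by rewrite invr_gt0.
  rewrite -[X in gauge B X <= _]hdil1 -(mulVf (lt0r_neq0 l0)) -hdil_hdil mulrC.
  exact: Ndil_le.
apply/seteqP; split=> p /=.
  by move=> Bp; apply: Nle; split; rewrite ?invr1 ?hdil1.
move=> N1; apply: Bclosed => t /andP[t0 t1]; rewrite -[t]invrK.
by apply: (Sgt _ _ _).2; apply: le_lt_trans N1 _; rewrite invf_gt1.
Qed.

(** * The body in coordinates, and estimates on [K] and [g] *)

Lemma hbodyE (R : realType) (K : set (horizontal R)) (f : horizontal R -> R)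
    (p : heisenberg R) :
  hbody K f p <-> K p.1 /\ - f (- p.1) <= p.2 <= f p.1.
Proof.
have E (v : horizontal R) z : hincl v + z *: hZ R = (v, z).
  case: v => x y; rewrite /hincl /hX /hY /hZ.
  by congr (_, _, _) => /=; rewrite /GRing.scale /=; ring.
split=> [[v [z [Kv fz ->]]]|[Kp fp]]; first by rewrite E.
by exists p.1, p.2; rewrite E -surjective_pairing.
Qed.

Lemma lipschitz_withinP (R : realType) (V W : normedModType R) (A : set V)
    (f : V -> W) :
  [lipschitz f x | x in A] ->
  exists2 L : R, 0 <= L &
    forall x y, A x -> A y -> `|f x - f y| <= L * `|x - y|.
Proof.
(* The bound holds for every constant above [M]; [|M| + 1] is one that is also nonnegative. *)
move=> [M [Mreal fM]]; exists (`|M| + 1); first by rewrite addr_ge0.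
move=> x y Ax Ay; apply: (fM (`|M| + 1) _ (x, y)) => //.
by rewrite (le_lt_trans (ler_norm M))// ltrDl.
Qed.

Lemma compact_norm_le (R : realType) (V : normedModType R) (A : set V) :
  compact A -> exists2 C : R, 0 <= C & forall x, A x -> `|x| <= C.
Proof.
move=> /compact_bounded[M [Mreal AM]]; exists (`|M| + 1).
  by rewrite addr_ge0.
by apply: AM; rewrite (le_lt_trans (ler_norm M))// ltrDl.
Qed.

Lemma convex_set_combination (R : realType) (V : lmodType R) (A : set V)
    (s t : R) (x y : V) :
  convex_set A -> 0 <= s -> 0 <= t -> s + t = 1 -> A x -> A y ->
  A (s *: x + t *: y).
Proof.
move=> Acvx s0 t0 st Ax Ay.
have s1 : s <= 1 by lra.
have := Acvx x y (Itv01 s0 s1).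
rewrite !inE (_ : t = unstable.onem s) => [/(_ Ax Ay)//|].
by rewrite /unstable.onem; lra.
Qed.

Lemma horizontal_le (R : realType) (v : horizontal R) (C : R) :
  `|v| <= C <-> `|v.1| <= C /\ `|v.2| <= C.
Proof. by rewrite prod_normE /= ge_max; split=> [/andP|[-> ->]]. Qed.

Lemma interior0_absorbing (R : realType) (V : normedModType R) (A : set V) :
  interior A 0 -> exists2 r : R, 0 < r & forall x, `|x| < r -> A x.
Proof.
move=> /nbhs_ballP[r r0 rA]; exists r => // x xr; apply: rA.
by rewrite -ball_normE /= sub0r normrN.
Qed.

Lemma closed_radial (R : realType) (V : normedModType R) (A : set V) (x : V) :
  closed A -> (forall t : R, 0 < t < 1 -> A (t *: x)) -> A x.
Proof.
move=> Acl xA.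
apply: (@closed_cvg _ _ ((1 : R)^'-) _ (fun t => t *: x) A Acl).
  near=> t; apply: xA; apply/andP; split; near: t.
    by apply: nbhs_left_gt.
  by apply: nbhs_left_lt.
rewrite -[X in _ --> X]scale1r; apply: cvgZr_tmp.
by apply: cvg_at_left_filter; apply: cvg_id.
Unshelve. all: by end_near. Qed.

(** The coefficients of [s t] are at most [4 L C] from the two Lipschitz increments,
    [2 (|g 0| + L C)] from [- g v - g w], and [C^2] from [D / 2]. They are absorbed by [2 b].
    Leaving [D] free allows both signs of the area form. *)
Lemma lipschitz_square_concave (R : realType) (V : normedModType R) (K : set V)
    (g : V -> R) (L C b : R) :
  convex_set K -> 0 <= L ->
  (forall x y, K x -> K y -> `|g x - g y| <= L * `|x - y|) ->
  (forall x, K x -> `|x| <= C) -> K 0 -> 3 * (L * C) + `|g 0| + C ^+ 2 <= b ->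
  forall (v w : V) (s t D : R), K v -> K w -> 0 <= s -> 0 <= t -> s + t = 1 ->
    `|D| <= 2 * C ^+ 2 ->
  s ^+ 2 * (g v + b) + t ^+ 2 * (g w + b) + 2^-1 * (s * t * D) <=
    g (s *: v + t *: w) + b.
Proof.
move=> Kcvx L0 gL KC K0 hb v w s t D Kv Kw s0 t0 st hD.
have Ku : K (s *: v + t *: w) by exact: convex_set_combination.
set u := s *: v + t *: w in Ku *.
have vu : v - u = t *: (v - w).
  rewrite /u opprD addrA -[X in X - s *: v]scale1r -scalerBl scalerBr.
  by rewrite (_ : 1 - s = t)//; lra.
have wu : w - u = s *: (w - v).
  rewrite /u [s *: v + _]addrC opprD addrA -[X in X - t *: w]scale1r.
  by rewrite -scalerBl scalerBr (_ : 1 - t = s)//; lra.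
have wv2 : `|v - w| <= 2 * C.
  by rewrite (le_trans (ler_normB _ _))// mulr2n mulrDl mul1r lerD// KC.
have gvu : g v - g u <= t * (L * (2 * C)).
  rewrite (le_trans (ler_norm _))// (le_trans (gL _ _ Kv Ku))//.
  by rewrite vu normrZ ger0_norm// mulrCA ler_wpM2l// ler_wpM2l.
have gwu : g w - g u <= s * (L * (2 * C)).
  rewrite (le_trans (ler_norm _))// (le_trans (gL _ _ Kw Ku))//.
  by rewrite wu normrZ ger0_norm// mulrCA ler_wpM2l// ler_wpM2l// distrC.
have gneg x : K x -> - g x <= `|g 0| + L * C.
  move=> Kx; have := le_trans (ler_norm _) (gL _ _ K0 Kx).
  rewrite sub0r normrN => h.
  have := ler_wpM2l L0 (KC _ Kx); have := ler_norm (- g 0); rewrite normrN; lra.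
have gv := gneg _ Kv; have gw := gneg _ Kw.
have D2 : D <= 2 * C ^+ 2 := le_trans (ler_norm D) hD.
have st0 : 0 <= s * t by exact: mulr_ge0.
(* s^2 = s - s t and t^2 = t - s t reduce the claim to the bounds h1 to h5 *)
have h1 := ler_wpM2l s0 gvu; have h2 := ler_wpM2l t0 gwu.
have h3 : s * t * (- g v - g w + 2^-1 * D) <=
    s * t * (2 * (`|g 0| + L * C) + C ^+ 2) by rewrite ler_wpM2l//; lra.
have h4 := ler_wpM2l st0 hb.
have h5 : 0 <= s * t * (C ^+ 2) by rewrite mulr_ge0// sqr_ge0.
have te : t = 1 - s by lra.
rewrite {}te in h1 h2 h3 h4 h5 *; lra.
Qed.

(** * Limit arguments in one real parameter *)

Lemma le0_of_bounded_multiples (R : realType) (a c : R) :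
  (forall t, 0 < t -> t * a <= c) -> a <= 0.
Proof.
move=> ac; rewrite leNgt; apply/negP => a0.
have d0 : 0 < (`|c| + 1) / a by rewrite divr_gt0// ltr_wpDl.
have := ac _ d0; rewrite divfK ?gt_eqF//; have := ler_norm c; lra.
Qed.

Lemma le_of_sqr_scaled (R : realType) (z a c : R) : 0 <= c ->
  (forall t, 0 < t < 1 -> t ^+ 2 * z <= a + c * (1 - t)) -> z <= a.
Proof.
move=> c0 hz; rewrite leNgt; apply/negP => az.
have e0 : 0 < z - a by lra.
have z0 := normr_ge0 z; have zz := ler_norm z.
(* Lowering [t] from 1 to [1 - h] costs at most [h (2 |z| + c)], which is less than [h d = z - a];
   the summand [z - a + 1] forces [h < 1]. *)
set d := 2 * `|z| + c + (z - a) + 1; have d0 : 0 < d by rewrite /d; lra.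
(* t = 1 - h violates the hypothesis *)
set h := (z - a) / d.
have h0 : 0 < h by rewrite divr_gt0.
have h1 : h < 1 by rewrite ltr_pdivrMr// mul1r /d; lra.
have hd : h * d = z - a by rewrite divfK// gt_eqF.
have := hz (1 - h); rewrite (_ : 0 < 1 - h < 1); last by lra.
move=> /(_ isT); apply/negP; rewrite -ltNge.
have hz' := ler_wpM2l (ltW h0) zz.
have hhz : 0 <= h ^+ 2 * (`|z| + z).
  rewrite mulr_ge0 ?sqr_ge0//.
  by have := ler_norm (- z); rewrite normrN; lra.
have hh : h * h <= h by rewrite -[leRHS]mulr1 ler_wpM2l ?ltW.
have hhz2 := ler_wpM2r z0 hh.
have hhe : 0 < h * (z - a) by exact: mulr_gt0.
rewrite /d in hd.
nra.
Qed.

(** * The choice of [b] and the five gauge hypotheses for the body *)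

Theorem proposition6p3 (R : realType) (K : set (horizontal R))
    (g : horizontal R -> R)
    (Kcompact : compact K) (Kconvex : convex_set K)
    (Ksym : [set - v | v in K] = K) (K0 : interior K 0)
    (glip : [lipschitz g v | v in K]) :
  exists b : R, exists N : heisenberg R -> R,
    homogeneous_norm N /\
    hbody K (fun v => g v + b) = [set p | N p <= 1].
Proof.
have [L L0 gL] := lipschitz_withinP glip.
have [C C0 KC] := compact_norm_le Kcompact.
have KN v : K v -> K (- v) by move=> Kv; rewrite -Ksym; exists v.
have K00 : K 0 := interior_subset K0.
(* The final [+ 1] exceeds what concavity asks for and gives [f >= 1] on [K], as absorption
   needs. *)
set b := 3 * (L * C) + `|g 0| + C ^+ 2 + 1.
exists b, (gauge (hbody K (fun v => g v + b))).
have f1 v : K v -> 1 <= g v + b.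
  move=> Kv; have := le_trans (ler_norm _) (gL _ _ K00 Kv).
  rewrite sub0r normrN => h; have := ler_wpM2l L0 (KC _ Kv).
  have := ler_norm (- g 0); rewrite normrN /b.
  have := mulr_ge0 L0 C0; have := sqr_ge0 C; lra.
have area v w : K v -> K w -> `|v.1 * w.2 - v.2 * w.1| <= 2 * C ^+ 2.
  move=> /KC/horizontal_le[v1 v2] /KC/horizontal_le[w1 w2].
  rewrite (le_trans (ler_normB _ _))// !normrM mulr2n mulrDl mul1r expr2.
  by rewrite lerD// ler_pM.
have fconc : forall (v w : horizontal R) (s t D : R), K v -> K w ->
    0 <= s -> 0 <= t -> s + t = 1 -> `|D| <= 2 * C ^+ 2 ->
    s ^+ 2 * (g v + b) + t ^+ 2 * (g w + b) + 2^-1 * (s * t * D) <=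
    g (s *: v + t *: w) + b.
  move=> v w s t D Kv Kw s0 t0 st hD.
  apply: (lipschitz_square_concave Kconvex L0 gL KC K00) => //.
  by rewrite /b lerDl.
apply gauge_norm.
- move=> p /hbodyE[Kp /andP[pl pu]]; apply/hbodyE; split; first exact: KN.
  by rewrite /= opprK lerN2 pu/= lerNl.
- move=> s t p q s0 t0 st /hbodyE[Kp /andP[pl pu]] /hbodyE[Kq /andP[ql qu]].
  apply/hbodyE; rewrite !hdilE hmulE /=.
  change (s * hx p + t * hx q, s * hy p + t * hy q) with (s *: p.1 + t *: q.1).
  split.
    exact: (@convex_set_combination _ (horizontal R)) Kconvex s0 t0 st Kp Kq.
  set D := p.1.1 * q.1.2 - p.1.2 * q.1.1.
  have hD : `|D| <= 2 * C ^+ 2 by exact: area.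
  (* The area form is unchanged when both points are negated, but the lower bound reverses the sign
     of the vertical coordinate, so [D] enters as [- D]. *)
  have hND : `|- D| <= 2 * C ^+ 2 by rewrite normrN.
  have fl := fconc _ _ _ _ _ (KN _ Kp) (KN _ Kq) s0 t0 st hND.
  have fu := fconc _ _ _ _ _ Kp Kq s0 t0 st hD.
  have eN : s *: - p.1 + t *: - q.1 = - (s *: p.1 + t *: q.1).
    by rewrite !scalerN opprD.
  rewrite eN in fl.
  have s20 := sqr_ge0 s; have t20 := sqr_ge0 t.
  have hpl := ler_wpM2l s20 pl; have hpu := ler_wpM2l s20 pu.
  have hql := ler_wpM2l t20 ql; have hqu := ler_wpM2l t20 qu.
  rewrite /hx /hy /hz /=.
  rewrite (_ : s * p.1.1 * (t * q.1.2) - s * p.1.2 * (t * q.1.1) = s * t * D);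
    last by rewrite /D; ring.
  by apply/andP; split; lra.
- move=> p; have [r r0 rK] := interior0_absorbing K0.
  have n1 := normr_ge0 p.1; have n2 := normr_ge0 p.2.
  have n1r : 0 <= `|p.1| / r by rewrite divr_ge0// ltW.
  (* The summand [|p.1| / r] brings the horizontal part into the ball of radius [r], [|p.2|] brings
     the height below 1, and the 1 gives [d^-1 <= 1], so that squaring does no harm. *)
  set d := 1 + `|p.1| / r + `|p.2|; have d0 : 0 < d by rewrite /d; lra.
  have ti0 : 0 < d^-1 by rewrite invr_gt0.
  exists d^-1 => //; apply/hbodyE; rewrite hdilE /=.
  change (d^-1 * hx p, d^-1 * hy p) with (d^-1 *: p.1).
  have Kp : K (d^-1 *: p.1).
    apply: rK; rewrite normrZ gtr0_norm// mulrC ltr_pdivrMr// mulrC.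
    by rewrite -ltr_pdivrMr// /d; lra.
  split=> //; have := f1 _ Kp; have := f1 _ (KN _ Kp).
  suff : `|d^-1 ^+ 2 * p.2| <= 1 by rewrite ler_norml => /andP[? ?] ? ?; lra.
  have ti1 : d^-1 <= 1 by rewrite invf_le1// /d; lra.
  have tp1 : d^-1 * `|p.2| <= 1 by rewrite mulrC ler_pdivrMr// mul1r /d; lra.
  rewrite normrM ger0_norm ?sqr_ge0// expr2 -mulrA.
  by rewrite mulr_ile1// ?mulr_ge0// ltW.
- move=> [v z] pB.
  have inB t : 0 < t -> K (t *: v) /\
      - (g (- (t *: v)) + b) <= t ^+ 2 * z <= g (t *: v) + b.
    by move=> /pB/hbodyE; rewrite hdilE.
  have v0 : v = 0.
    apply/eqP; rewrite -normr_le0.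
    apply: (@le0_of_bounded_multiples _ _ C) => t t0.
    by have := KC _ (inB _ t0).1; rewrite normrZ gtr0_norm.
  (* Dilating by the square root of [t] makes the height linear in [t]. *)
  have zle t : 0 < t -> - (g 0 + b) <= t * z <= g 0 + b.
    move=> t0; have st0 : 0 < Num.sqrt t by rewrite sqrtr_gt0.
    by have [_] := inB _ st0; rewrite v0 scaler0 oppr0 sqr_sqrtr// ltW.
  have z_le0 : z <= 0.
    by apply: (@le0_of_bounded_multiples _ _ (g 0 + b)) => t /zle/andP[].
  have z_ge0 : - z <= 0.
    apply: (@le0_of_bounded_multiples _ _ (g 0 + b)) => t /zle/andP[].
    by rewrite mulrN lerNl.
  by rewrite v0 (_ : z = 0)//; lra.
- move=> [v z] pB.
  have inB t : 0 < t < 1 -> K (t *: v) /\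
      - (g (- (t *: v)) + b) <= t ^+ 2 * z <= g (t *: v) + b.
    by move=> /pB/hbodyE; rewrite hdilE.
  have Kv : K v.
    apply: closed_radial => [|t /inB[]//].
    by apply: compact_closed => //; exact: norm_hausdorff.
  (* Since [t w] and [w] differ by [(1 - t) |w|] in norm, this is the error term that
     [le_of_sqr_scaled] tolerates; it is used at [v] and at [- v]. *)
  have gt w t : K w -> K (t *: w) -> 0 < t < 1 ->
      g (t *: w) <= g w + L * C * (1 - t).
    move=> Kw Ktw /andP[t0 t1]; rewrite -lerBlDl.
    rewrite (le_trans (ler_norm _))// (le_trans (gL _ _ Ktw Kw))// -mulrA.
    rewrite ler_wpM2l// -[X in _ *: w - X]scale1r -scalerBl normrZ distrC.
    have t1' : 0 <= 1 - t by lra.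
    by rewrite ger0_norm// mulrC ler_wpM2r// KC.
  have LC0 := mulr_ge0 L0 C0.
  apply/hbodyE; split=> //=; apply/andP; split.
    rewrite lerNl; apply: (le_of_sqr_scaled LC0) => t t01.
    have [Ktv /andP[zl _]] := inB _ t01.
    have := gt (- v) t (KN _ Kv); rewrite scalerN => /(_ (KN _ Ktv) t01).
    lra.
  apply: (le_of_sqr_scaled LC0) => t t01.
  have [Ktv /andP[_ zu]] := inB _ t01; have := gt v t Kv Ktv t01; lra.
Qed.
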